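(* Let $A$, $B$, $C$ be finite-dimensional algebras over a field $K$, and let $R(A,B,C)$ be a recollement of $\operatorname{mod}B$ relative to $\operatorname{mod}A$ and $\operatorname{mod}C$, with functors $i^{*}, i_{*}, i^{!}, j_{!}, j^{*}, j_{*}$ and intermediate extension functor $j_{!*}$. Then: (a) The functor $i_{*}$ maps semibricks in $\operatorname{mod}A$ to semibricks in $\operatorname{mod}B$. (b) Each of the functors $j_{!}$, $j_{*}$ and $j_{!*}$ maps semibricks in $\operatorname{mod}C$ to semibricks in $\operatorname{mod}B$. (c) For every semibrick $\mathcal{S}_{L}$ in $\operatorname{mod}A$ and every semibrick $\mathcal{S}_{R}$ in $\operatorname{mod}C$, the set $i_{*}(\mathcal{S}_{L})\sqcup j_{!*}(\mathcal{S}_{R})$ is a semibrick in $\operatorname{mod}B$, and the assignment $(\mathcal{S}_{L},\mathcal{S}_{R})\mapsto i_{*}(\mathcal{S}_{L})\sqcup j_{!*}(\mathcal{S}_{R})$ is an injection from the set of pairs consisting of a semibrick in $\operatorname{mod}A$ and a semibrick in $\operatorname{mod}C$ to the set of semibricks in $\operatorname{mod}B$.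
   Context: For a finite-dimensional $K$-algebra $A$, $\operatorname{mod}A$ is the category of finitely generated right $A$-modules. Semibricks: a module $S\in\operatorname{mod}A$ is a brick if $\operatorname{End}_A(S)$ is a division $K$-algebra (in particular $S\neq 0$). A semibrick in $\operatorname{mod}A$ is a set $\mathcal{S}$ of isomorphism classes of bricks in $\operatorname{mod}A$ such that $\operatorname{Hom}_A(S_1,S_2)=0$ for all $S_1\neq S_2$ in $\mathcal{S}$ (the empty set is a semibrick). For a functor $F$ and a set $\mathcal{S}$ of isomorphism classes of modules, $F(\mathcal{S})$ is the set of isomorphism classes of $F(S)$, $S\in\mathcal{S}$. The symbol $\sqcup$ denotes disjoint union. Recollement: for finite-dimensional algebras $A,B,C$, a recollement $R(A,B,C)$ of $\operatorname{mod}B$ relative to $\operatorname{mod}A$ and $\operatorname{mod}C$ consists of functors $i_*:\operatorname{mod}A\to\operatorname{mod}B$, $i^*,i^!:\operatorname{mod}B\to\operatorname{mod}A$, $j^*:\operatorname{mod}B\to\operatorname{mod}C$, $j_!,j_*:\operatorname{mod}C\to\operatorname{mod}B$ such that (1) $(i^*,i_* )$, $(i_*,i^!)$, $(j_!,j^* )$ and $(j^*,j_* )$ are adjoint pairs (left adjoint first); (2) $i_*$, $j_!$ and $j_*$ are fully faithful; (3) $\operatorname{Im}i_*=\operatorname{Ker}j^*$ (essential image of $i_*$ equals the full subcategory of objects killed by $j^*$). Intermediate extension functor: $j_{!*}:=\operatorname{Im}(j_!\to j_* ):\operatorname{mod}C\to\operatorname{mod}B$, where $j_!\to j_*$ is the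 canonical natural transformation, whose component $j_!X\to j_*X$ corresponds to $\mathrm{id}_X$ under $\operatorname{Hom}_B(j_!X,j_*X)\cong\operatorname{Hom}_C(X,j^*j_*X)\cong\operatorname{Hom}_C(X,X)$. *)

(* Defs.v *)
From HB Require Import structures.
From mathcomp Require Import all_boot all_algebra falgebra.
From mathcomp Require Import boolp.

Set Implicit Arguments.
Unset Strict Implicit.
Unset Printing Implicit Defensive.

Import GRing.Theory.
Local Open Scope ring_scope.

Record category := Category {
  obj :> Type;
  hom : obj -> obj -> Type;
  idm : forall X, hom X X;
  comp : forall X Y Z, hom Y Z -> hom X Y -> hom X Z;
  comp_idl : forall X Y (f : hom X Y), comp (idm Y) f = f;
  comp_idr : forall X Y (f : hom X Y), comp f (idm X) = f;
  comp_assoc : forall W X Y Z (h : hom Y Z) (g : hom X Y) (f : hom W X),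
    comp h (comp g f) = comp (comp h g) f
}.

Arguments hom {c} X Y : rename.
Arguments idm {c} X : rename.

Declare Scope cat_scope.
Delimit Scope cat_scope with cat.
Local Open Scope cat_scope.
Notation "g \oc f" := (comp g f)
  (at level 50, left associativity, format "g  \oc  f") : cat_scope.

Record functor (C D : category) := Functor {
  fobj :> C -> D;
  fmap : forall X Y, hom X Y -> hom (fobj X) (fobj Y);
  fmap_id : forall X, fmap (idm X) = idm (fobj X);
  fmap_comp : forall X Y Z (g : hom Y Z) (f : hom X Y),
    fmap (g \oc f) = fmap g \oc fmap f
}.

Arguments fmap {C D} F {X Y} f : rename.

Definition fully_faithful (C D : category) (F : functor C D) : Prop :=
  forall X Y : C, bijective (@fmap _ _ F X Y).

(* F is left adjoint to G *)
Record adjunction (C D : category) (F : functor C D) (G : functor D C) :=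
  Adjunction {
    adj : forall X Y, hom (F X) Y -> hom X (G Y);
    adj_inv : forall X Y, hom X (G Y) -> hom (F X) Y;
    adjK : forall X Y, cancel (@adj X Y) (@adj_inv X Y);
    adj_invK : forall X Y, cancel (@adj_inv X Y) (@adj X Y);
    adj_nat : forall X X' Y Y'
        (h : hom X' X) (f : hom (F X) Y) (g : hom Y Y'),
      adj (g \oc (f \oc fmap F h)) = fmap G g \oc (adj f \oc h)
  }.

Arguments adj {C D F G} a {X Y} f : rename.
Arguments adj_inv {C D F G} a {X Y} f : rename.

Section AdjunctionTheory.
Variables (C D : category) (F : functor C D) (G : functor D C).
Variable a : adjunction F G.

Lemma adj_natr X Y Y' (f : hom (F X) Y) (g : hom Y Y') :
  adj a (g \oc f) = fmap G g \oc adj a f.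
Proof. by have := adj_nat a (idm X) f g; rewrite fmap_id !comp_idr. Qed.

Lemma adj_natl X X' Y (h : hom X' X) (f : hom (F X) Y) :
  adj a (f \oc fmap F h) = adj a f \oc h.
Proof. by have := adj_nat a h f (idm Y); rewrite fmap_id !comp_idl. Qed.

Lemma adj_inj X Y : injective (@adj _ _ _ _ a X Y).
Proof. exact: can_inj (@adjK _ _ _ _ a X Y). Qed.

Definition counit (Y : D) : hom (F (G Y)) Y := adj_inv a (idm (G Y)).

Lemma counit_nat Y Y' (g : hom Y Y') :
  g \oc counit Y = counit Y' \oc fmap F (fmap G g).
Proof.
apply: (@adj_inj _ _).
by rewrite adj_natr adj_natl !adj_invK comp_idl comp_idr.
Qed.

Lemma counit_iso (Y : D) : fully_faithful G ->
  exists g : hom Y (F (G Y)),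
    counit Y \oc g = idm Y /\ g \oc counit Y = idm (F (G Y)).
Proof.
move=> ffG; have [inv invK Kinv] := ffG Y (F (G Y)).
pose g := inv (adj a (idm (F (G Y)))); exists g; split.
  apply: (bij_inj (ffG Y Y)); rewrite fmap_comp Kinv -adj_natr comp_idr.
  by rewrite adj_invK fmap_id.
by apply: (@adj_inj _ _); rewrite adj_natr Kinv adj_invK comp_idr.
Qed.

End AdjunctionTheory.

Definition iso (C : category) (X Y : C) : Prop :=
  exists (f : hom X Y) (g : hom Y X), g \oc f = idm X /\ f \oc g = idm Y.

(* The library's [set T] is confined to a universe too small for T to be the
   type of all modules over a ring, so plain predicates are used for sets of
   objects; by functional and propositional extensionality, [=] on them is
   extensional equality.  [isoclass X] is the isomorphism class of X, and a set
   of isomorphism classes of objects of C has type [(C -> Prop) -> Prop]. *)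
Definition isoclass (C : category) (X : C) : C -> Prop := fun Y => iso X Y.

Definition fimage (C D : category) (F : functor C D)
    (S : (C -> Prop) -> Prop) : (D -> Prop) -> Prop :=
  fun c => exists2 X : C, S (isoclass X) & c = isoclass (F X).

Definition disjoint_classes (C : category) (S T : (C -> Prop) -> Prop) : Prop :=
  forall c, S c -> T c -> False.

Definition union_classes (C : category) (S T : (C -> Prop) -> Prop) :
    (C -> Prop) -> Prop :=
  fun c => S c \/ T c.

(* A K-algebra is a ring with a central ring morphism from K.  MathComp's
   [algType] and [falgType] exclude the zero algebra, whose module category
   occurs in degenerate recollements. *)
Record fdAlgebra (K : fieldType) := FDAlgebra {
  fdalg_ring :> pzRingType;
  fdalg_in : {rmorphism K -> fdalg_ring};
  fdalg_central : forall (k : K) (x : fdalg_ring),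
    fdalg_in k * x = x * fdalg_in k;
  fdalg_fin : exists (n : nat) (e : 'I_n -> fdalg_ring),
    forall x, exists c : 'I_n -> K, x = \sum_(i < n) fdalg_in (c i) * e i
}.

Lemma falg_central (K : fieldType) (A : falgType K) (k : K) (x : A) :
  in_alg A k * x = x * in_alg A k.
Proof. by rewrite /= -scalerAl -scalerAr mul1r mulr1. Qed.

Lemma falg_fin (K : fieldType) (A : falgType K) :
  exists (n : nat) (e : 'I_n -> A),
    forall x, exists c : 'I_n -> K, x = \sum_(i < n) in_alg A (c i) * e i.
Proof.
exists (\dim (fullv : {vspace A})), (fun i => (vbasis (fullv : {vspace A}))`_i).
move=> x; exists (fun i => coord (vbasis fullv) i x).
rewrite {1}(coord_vbasis (memvf x)).
by apply: eq_bigr => i _; rewrite -scalerAl mul1r.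
Qed.

Definition fdalg_of_falg (K : fieldType) (A : falgType K) : fdAlgebra K :=
  FDAlgebra (@falg_central K A) (falg_fin A).

(* A right R-module is a left module over the converse ring R^c. *)
Record fgmod (R : pzRingType) := FGMod {
  fgmod_sort :> lmodType R^c;
  fgmod_fin : exists (n : nat) (g : 'I_n -> fgmod_sort),
    forall x, exists c : 'I_n -> R^c, x = \sum_(i < n) c i *: g i
}.

Lemma linear_ext (R : pzRingType) (M N : lmodType R) (f g : {linear M -> N}) :
  f =1 g -> f = g.
Proof.
case: f g => [f [[f1] [f2]]] [g [[g1] [g2]]] /= /funext e.
by subst g; congr (GRing.Linear.Pack (GRing.Linear.Class _ _)); congr (_ _);
  exact: Prop_irrelevance.
Qed.

Section ModCat.
Variable R : pzRingType.

Definition mod_hom (M N : fgmod R) : Type := {linear M -> N}.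
Definition mod_id (M : fgmod R) : mod_hom M M := (idfun : {linear M -> M}).
Definition mod_comp (M N P : fgmod R) (g : mod_hom N P) (f : mod_hom M N) :
  mod_hom M P := ((g : {linear N -> P}) \o (f : {linear M -> N})).

Lemma mod_comp_idl M N (f : mod_hom M N) : mod_comp (mod_id N) f = f.
Proof. exact: linear_ext. Qed.
Lemma mod_comp_idr M N (f : mod_hom M N) : mod_comp f (mod_id M) = f.
Proof. exact: linear_ext. Qed.
Lemma mod_comp_assoc M N P Q (h : mod_hom P Q) (g : mod_hom N P)
  (f : mod_hom M N) : mod_comp h (mod_comp g f) = mod_comp (mod_comp h g) f.
Proof. exact: linear_ext. Qed.

Definition modcat : category :=
  Category mod_comp_idl mod_comp_idr mod_comp_assoc.

End ModCat.

Section ModNotions.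
Variable R : pzRingType.
Implicit Types M N S : modcat R.

Definition mod_zero M N : hom M N :=
  (\0 : {linear (M : fgmod R) -> (N : fgmod R)}).

Definition is_zero M : Prop := forall x : (M : fgmod R), x = 0.

(* End(S), with unit [idm S] and product [\oc], is a division ring *)
Definition brick S : Prop :=
  idm S <> mod_zero S S /\
  forall f : hom S S, f <> mod_zero S S ->
    exists g : hom S S, g \oc f = idm S /\ f \oc g = idm S.

Definition semibrick (X : (modcat R -> Prop) -> Prop) : Prop :=
  (forall c, X c -> exists2 S : modcat R, brick S & c = isoclass S) /\
  forall S1 S2 : modcat R, X (isoclass S1) -> X (isoclass S2) ->
    isoclass S1 <> isoclass S2 -> forall f : hom S1 S2, f = mod_zero S1 S2.

End ModNotions.

Section Image.
Variables (R : pzRingType) (M N : fgmod R) (f : {linear M -> N}).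

Definition im_pred : pred N := fun y => `[< exists x, f x = y >].

Fact im_closed : subsemimod_closed im_pred.
Proof.
split; first split.
- by apply/asboolP; exists 0; rewrite linear0.
- move=> y y' /asboolP[x <-] /asboolP[x' <-].
  by apply/asboolP; exists (x + x'); rewrite linearD.
- move=> a y /asboolP[x <-].
  by apply/asboolP; exists (a *: x); rewrite linearZ.
Qed.

Record im_sort : Type := ImSort { im_val : N; im_valP : im_pred im_val }.

HB.instance Definition _ := [isSub for im_val].
HB.instance Definition _ := [Choice of im_sort by <:].
HB.instance Definition _ :=
  GRing.SubChoice_isSubLmodule.Build R^c N im_pred im_sort im_closed.

Definition im_incl : {linear im_sort -> N} := (val : {linear im_sort -> N}).

Fact im_inP x : im_pred (f x). Proof. by apply/asboolP; exists x. Qed.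
Definition im_proj x : im_sort := ImSort (im_inP x).

Fact im_proj_linear : linear im_proj.
Proof. by move=> a x y; apply: val_inj; rewrite /= linearP. Qed.
HB.instance Definition _ :=
  GRing.isLinear.Build R^c M im_sort *:%R im_proj im_proj_linear.

Lemma im_proj_surj (y : im_sort) : exists x, im_proj x = y.
Proof.
by case: y => y yP; have /asboolP[x e] := yP; exists x; apply: val_inj.
Qed.

Fact im_fin : exists (n : nat) (g : 'I_n -> im_sort),
  forall x, exists c : 'I_n -> R^c, x = \sum_(i < n) c i *: g i.
Proof.
have [n [g gP]] := fgmod_fin M; exists n, (im_proj \o g) => y.
have [x <-] := im_proj_surj y; have [c ->] := gP x; exists c.
by rewrite linear_sum; apply: eq_bigr => i _; rewrite linearZ.
Qed.

Definition im_mod : fgmod R := FGMod im_fin.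

End Image.

Record recollement (K : fieldType) (A B C : fdAlgebra K) := Recollement {
  i_lower_star   : functor (modcat A) (modcat B);
  i_upper_star   : functor (modcat B) (modcat A);
  i_upper_shriek : functor (modcat B) (modcat A);
  j_upper_star   : functor (modcat B) (modcat C);
  j_lower_shriek : functor (modcat C) (modcat B);
  j_lower_star   : functor (modcat C) (modcat B);
  adj_iUs_iLs : adjunction i_upper_star i_lower_star;
  adj_iLs_iUk : adjunction i_lower_star i_upper_shriek;
  adj_jLk_jUs : adjunction j_lower_shriek j_upper_star;
  adj_jUs_jLs : adjunction j_upper_star j_lower_star;
  i_lower_star_ff   : fully_faithful i_lower_star;
  j_lower_shriek_ff : fully_faithful j_lower_shriek;
  j_lower_star_ff   : fully_faithful j_lower_star;
  im_ker : forall Y : modcat B,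
    (exists X : modcat A, iso (i_lower_star X) Y) <-> is_zero (j_upper_star Y)
}.

Section Intermediate.
Variables (K : fieldType) (A B C : fdAlgebra K) (R : recollement A B C).

Local Notation jk := (j_lower_shriek R).
Local Notation ju := (j_upper_star R).
Local Notation js := (j_lower_star R).
Local Notation eps X := (counit (adj_jUs_jLs R) X).

(* The component at X of the canonical transformation j_! -> j_*: it
   corresponds to [idm X] under
   Hom(j_! X, j_* X) ~ Hom(X, j^* j_* X) ~ Hom(X, X),
   the second bijection being composition with the (invertible) counit. *)
Lemma canonical_exists (X : modcat C) : exists! c : hom (jk X) (js X),
  eps X \oc adj (adj_jLk_jUs R) c = idm X.
Proof.
have [g [eg ge]] := counit_iso (adj_jUs_jLs R) X (j_lower_star_ff R).
exists (adj_inv (adj_jLk_jUs R) g); split; first by rewrite adj_invK.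
move=> c /(congr1 (fun f => g \oc f)).
by rewrite comp_assoc ge comp_idl comp_idr => <-; rewrite adjK.
Qed.

Definition canonical (X : modcat C) : hom (jk X) (js X) :=
  sval (cid (canonical_exists X)).

Lemma canonicalE X : eps X \oc adj (adj_jLk_jUs R) (canonical X) = idm X.
Proof. by rewrite /canonical; case: cid => c []. Qed.

Lemma canonical_nat X Y (f : hom X Y) :
  fmap js f \oc canonical X = canonical Y \oc fmap jk f.
Proof.
have [g [eg ge]] := counit_iso (adj_jUs_jLs R) Y (j_lower_star_ff R).
apply: (@adj_inj _ _ _ _ (adj_jLk_jUs R)).
rewrite adj_natr adj_natl; apply: (can_inj (g := fun h => g \oc h)
  (f := fun h => eps Y \oc h)); first by move=> h; rewrite comp_assoc ge comp_idl.
rewrite comp_assoc -counit_nat -comp_assoc canonicalE comp_idr.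
by rewrite comp_assoc canonicalE comp_idl.
Qed.

Definition ie_obj (X : modcat C) : modcat B := im_mod (canonical X).

(* On morphisms, j_!* f is the restriction of j_* f to the images. *)
Lemma ie_mapP X Y (f : hom X Y) (y : im_sort (canonical X)) :
  im_pred (canonical Y) ((fmap js f : {linear _ -> _}) (im_val y)).
Proof.
have [x <-] := im_proj_surj y; apply/asboolP.
exists ((fmap jk f : {linear _ -> _}) x).
exact: (congr1 (fun h : {linear _ -> _} => h x) (esym (canonical_nat f))).
Qed.

Definition ie_fun X Y (f : hom X Y) (y : im_sort (canonical X)) :
  im_sort (canonical Y) := ImSort (ie_mapP f y).

Fact ie_fun_linear X Y (f : hom X Y) : linear (ie_fun f).
Proof. by move=> a x y; apply: val_inj; rewrite /= linearP. Qed.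
HB.instance Definition _ X Y (f : hom X Y) :=
  GRing.isLinear.Build B^c (im_sort (canonical X)) (im_sort (canonical Y))
    *:%R (ie_fun f) (ie_fun_linear f).

Definition ie_map X Y (f : hom X Y) : hom (ie_obj X) (ie_obj Y) :=
  (ie_fun f : {linear _ -> _}).

Fact ie_map_id X : ie_map (idm X) = idm (ie_obj X).
Proof.
by apply: linear_ext => y; apply: val_inj; rewrite /= fmap_id.
Qed.

Fact ie_map_comp X Y Z (g : hom Y Z) (f : hom X Y) :
  ie_map (g \oc f) = ie_map g \oc ie_map f.
Proof.
by apply: linear_ext => y; apply: val_inj; rewrite /= fmap_comp.
Qed.

Definition intermediate_ext : functor (modcat C) (modcat B) :=
  Functor ie_map_id ie_map_comp.

End Intermediate.

(* Main.v *)
From mathcomp Require Import all_boot all_algebra.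
From mathcomp Require Import boolp.
Require Import Defs.

(** Everything rests on three facts about functors between module categories.

    A fully faithful functor [F] preserves zero morphisms ([ff_mod_zero]):
    fullness writes the zero endomorphism of [F Y] as some [fmap F h], and then
    [fmap F 0 = fmap F (h \oc 0) = 0 \oc fmap F 0].
    Hence it preserves bricks, the vanishing of Hom and non-isomorphism, and so
    maps semibricks to semibricks ([ff_semibrick]).

    The intermediate extension is fully faithful ([intermediate_ext_ff]).
    Combining the adjunctions with the invertible counit of j^* -| j_*, every
    morphism j_! X -> j_* Y is [fmap j_* f \oc canonical X] for a unique
    [f : X -> Y].  A morphism between the images of the canonical maps at X and
    Y is determined by the morphism j_! X -> j_* Y that it induces, because
    j_! X surjects onto the first image and the second embeds in j_* Y.

    The essential images of i_* and j_!* are orthogonal in both directions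
    ([hom_i_ie], [hom_ie_i]): a morphism from i_* X to the image inside j_* Y
    corresponds to a morphism from j^* i_* X = 0 to Y, and a morphism from the
    image, a quotient of j_! Y, to i_* X corresponds to a morphism from Y to
    j^* i_* X = 0.

    The statements about unions are then formal for any two fully faithful
    functors with orthogonal images: an object isomorphic both to some [F X] and
    to some [G Y] has zero identity, so it is not a brick.  This gives
    disjointness, and it shows that each part can be recovered from the
    union. *)

Set Implicit Arguments.
Unset Strict Implicit.
Unset Printing Implicit Defensive.

Import GRing.Theory.
Local Open Scope cat_scope.

(** * Isomorphism classes *)

Section IsoClasses.
Variable C : category.
Implicit Types X Y Z : C.

Lemma iso_refl X : iso X X.
Proof. by exists (idm X), (idm X); rewrite comp_idl. Qed.

Lemma iso_sym X Y : iso X Y -> iso Y X.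
Proof. by move=> [f [g [gf fg]]]; exists g, f. Qed.

Lemma iso_trans X Y Z : iso X Y -> iso Y Z -> iso X Z.
Proof.
move=> [f [g [gf fg]]] [f' [g' [gf' fg']]]; exists (f' \oc f), (g \oc g'); split.
  by rewrite comp_assoc -(comp_assoc g) gf' comp_idr.
by rewrite comp_assoc -(comp_assoc f') fg comp_idr.
Qed.

Lemma comp_sandwich X X' Y Y' (a : hom X X') (b : hom X' X)
    (u : hom Y Y') (v : hom Y' Y) (h : hom X' Y') :
  a \oc b = idm X' -> u \oc v = idm Y' -> h = u \oc (v \oc h \oc a) \oc b.
Proof.
by move=> ab uv; rewrite !comp_assoc uv comp_idl -comp_assoc ab comp_idr.
Qed.

Lemma isoclass_eqP X Y : isoclass X = isoclass Y <-> iso X Y.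
Proof.
split=> [e | XY]; first by rewrite -/(isoclass X Y) e; exact: iso_refl.
apply/funext => Z; apply/propext; split; apply: iso_trans => //.
exact: iso_sym.
Qed.

End IsoClasses.

Lemma fmap_iso (C D : category) (F : functor C D) X Y :
  iso X Y -> iso (F X) (F Y).
Proof.
move=> [f [g [gf fg]]]; exists (fmap F f), (fmap F g).
by rewrite -!fmap_comp gf fg !fmap_id.
Qed.

Lemma ff_reflects_iso (C D : category) (F : functor C D) X Y :
  fully_faithful F -> iso (F X) (F Y) -> iso X Y.
Proof.
move=> ffF [f [g [gf fg]]].
have [f' _ Kf] := ffF X Y; have [g' _ Kg] := ffF Y X.
exists (f' f), (g' g); split; apply: (bij_inj (ffF _ _)).
  by rewrite fmap_comp Kf Kg gf fmap_id.
by rewrite fmap_comp Kf Kg fg fmap_id.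
Qed.

(** * Zero morphisms, bricks and semibricks *)

Section Modules.
Variable R : pzRingType.
Implicit Types M N P : modcat R.

Lemma comp0m M N P (f : hom M N) : mod_zero N P \oc f = mod_zero M P.
Proof. exact: linear_ext. Qed.

Lemma compm0 M N P (f : hom N P) : f \oc mod_zero M N = mod_zero M P.
Proof. by apply: linear_ext => x; exact: (linear0 (f : {linear _ -> _})). Qed.

Lemma hom0_iso M M' N N' : iso M M' -> iso N N' ->
  (forall f : hom M N, f = mod_zero M N) ->
  forall f : hom M' N', f = mod_zero M' N'.
Proof.
move=> [a [b [ba ab]]] [u [v [vu uv]]] MN0 f.
by rewrite (comp_sandwich f ab uv) (MN0 (v \oc f \oc a)) compm0 comp0m.
Qed.

Lemma hom_from_zero M N (f g : hom M N) : is_zero M -> f = g.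
Proof.
move=> M0; apply: linear_ext => x; rewrite (M0 x).
by rewrite (linear0 (f : {linear _ -> _})) (linear0 (g : {linear _ -> _})).
Qed.

Lemma hom_to_zero M N (f g : hom M N) : is_zero N -> f = g.
Proof. by move=> N0; apply: linear_ext => x; rewrite [LHS]N0 [RHS]N0. Qed.

Lemma brick_iso M N : iso M N -> brick M -> brick N.
Proof.
move=> [f [g [gf fg]]] [M1 Mdiv]; split=> [N10 | h h0].
  by apply: M1; rewrite -gf -[f]comp_idl N10 comp0m compm0.
have hE := comp_sandwich h fg fg.
have [|k [kh hk]] := Mdiv (g \oc h \oc f).
  by move=> e; apply: h0; rewrite hE e compm0 comp0m.
have conjM p q : f \oc p \oc g \oc (f \oc q \oc g) = f \oc (p \oc q) \oc g.
  by rewrite !comp_assoc -(comp_assoc _ g f) gf comp_idr.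
by exists (f \oc k \oc g); rewrite hE !conjM kh hk comp_idr fg.
Qed.

(** A set of classes records each brick by its class only, so properties of a
    chosen representative pass to every module in the class. *)
Lemma semibrick_brick S M : semibrick S -> S (isoclass M) -> brick M.
Proof.
move=> [Sbrick _] /Sbrick[N Nbrick /esym /isoclass_eqP NM].
exact: brick_iso NM Nbrick.
Qed.

Lemma semibrick_class S c : semibrick S -> S c ->
  exists2 M : modcat R, S (isoclass M) & c = isoclass M.
Proof.
by move=> [Sbrick _] Sc; have [M _ e] := Sbrick c Sc; exists M; rewrite -?e.
Qed.

End Modules.

Section FullyFaithful.
Variables (R R' : pzRingType) (F : functor (modcat R) (modcat R')).
Hypothesis ffF : fully_faithful F.
Implicit Types X Y : modcat R.

(** By fullness, the zero endomorphism of
    [F Y] equals some [fmap F h]; composing it with [fmap F 0] gives 0, and also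
    [fmap F (h \oc 0) = fmap F 0]. *)
Lemma ff_mod_zero X Y : fmap F (mod_zero X Y) = mod_zero (F X) (F Y).
Proof.
have [inv _ Kinv] := ffF Y Y; pose h := inv (mod_zero (F Y) (F Y)).
by rewrite -(compm0 X h) fmap_comp Kinv comp0m.
Qed.

Lemma ff_hom0 X Y : (forall f : hom X Y, f = mod_zero X Y) ->
  forall f : hom (F X) (F Y), f = mod_zero (F X) (F Y).
Proof.
move=> XY0 f; have [inv _ Kinv] := ffF X Y.
by rewrite -[f]Kinv (XY0 (inv f)) ff_mod_zero.
Qed.

Lemma ff_brick X : brick X -> brick (F X).
Proof.
move=> [X1 Xdiv]; split=> [FX10 | f f0].
  by apply: X1; apply: (bij_inj (ffF X X)); rewrite fmap_id ff_mod_zero.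
have [inv _ Kinv] := ffF X X.
have [|g [gf fg]] := Xdiv (inv f).
  by move=> e; apply: f0; rewrite -[f]Kinv e ff_mod_zero.
by exists (fmap F g); rewrite -[f]Kinv -!fmap_comp gf fg fmap_id.
Qed.

Lemma ff_semibrick S : semibrick S -> semibrick (fimage F S).
Proof.
move=> Ssemi; split=> [c [X SX ->] | M N].
  by exists (F X) => //; apply/ff_brick/(semibrick_brick Ssemi SX).
move=> [X SX /isoclass_eqP MX] [Y SY /isoclass_eqP NY] neqMN.
apply: (hom0_iso (iso_sym MX) (iso_sym NY)); apply: ff_hom0.
apply: Ssemi.2 => // /isoclass_eqP XY; apply: neqMN; apply/isoclass_eqP.
exact: iso_trans MX (iso_trans (fmap_iso F XY) (iso_sym NY)).
Qed.

End FullyFaithful.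

(** * Functors with orthogonal images *)

Definition hom_orthogonal (R1 R2 R : pzRingType)
    (F : functor (modcat R1) (modcat R)) (G : functor (modcat R2) (modcat R)) :=
  forall X Y (f : hom (F X) (G Y)), f = mod_zero (F X) (G Y).

Section Orthogonal.
Variables (R1 R2 R : pzRingType).
Variables (F : functor (modcat R1) (modcat R)).
Variables (G : functor (modcat R2) (modcat R)).
Hypotheses (ffF : fully_faithful F) (FG0 : hom_orthogonal F G).

Lemma orthogonal_disjoint S T : semibrick S ->
  disjoint_classes (fimage F S) (fimage G T).
Proof.
move=> Ssemi c [X SX ->] [Y _ /isoclass_eqP[f [g [gf _]]]].
have [FX1 _] := ff_brick ffF (semibrick_brick Ssemi SX).
by apply: FX1; rewrite -gf (FG0 f) compm0.
Qed.

Lemma orthogonal_union_semibrick S T : fully_faithful G ->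
  hom_orthogonal G F -> semibrick S -> semibrick T ->
  semibrick (union_classes (fimage F S) (fimage G T)).
Proof.
move=> ffG GF0 Ssemi Tsemi.
have FS := ff_semibrick ffF Ssemi; have GT := ff_semibrick ffG Tsemi.
split=> [c [/FS.1 | /GT.1] // | M N [FM | GM] [FN | GN]].
- exact: FS.2.
- have [X _ /isoclass_eqP MX] := FM; have [Y _ /isoclass_eqP NY] := GN.
  by move=> _; apply: (hom0_iso (iso_sym MX) (iso_sym NY)); apply: FG0.
- have [X _ /isoclass_eqP NX] := FN; have [Y _ /isoclass_eqP MY] := GM.
  by move=> _; apply: (hom0_iso (iso_sym MY) (iso_sym NX)); apply: GF0.
- exact: GT.2.
Qed.

(** The class of [F X] lies in the second union, and by disjointness in its
    [F]-part; fully faithful functors reflect isomorphism. *)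
Lemma orthogonal_union_sub S S' T T' : semibrick S -> semibrick S' ->
  union_classes (fimage F S) (fimage G T) =
    union_classes (fimage F S') (fimage G T') ->
  forall c, S c -> S' c.
Proof.
move=> Ssemi S'semi e c Sc; have [X SX cX] := semibrick_class Ssemi Sc.
have FX : fimage F S (isoclass (F X)) by exists X.
have : union_classes (fimage F S') (fimage G T') (isoclass (F X)).
  by rewrite -e; left.
case=> [[X' SX' /isoclass_eqP FXX'] | GX].
  rewrite cX; have /isoclass_eqP -> // := ff_reflects_iso ffF FXX'.
by case: (orthogonal_disjoint Ssemi FX GX).
Qed.

End Orthogonal.

(** * Image factorization *)

Section ImageFactorization.
Variables (R : pzRingType) (M N : modcat R) (f : hom M N).

Definition image : modcat R := im_mod f.
Definition image_incl : hom image N := im_incl f.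
Definition image_proj : hom M image := (im_proj f : {linear _ -> _}).

Lemma image_factor : image_incl \oc image_proj = f.
Proof. exact: linear_ext. Qed.

Lemma image_incl_mono P (g h : hom P image) :
  image_incl \oc g = image_incl \oc h -> g = h.
Proof.
move=> e; apply: linear_ext => x; apply: val_inj.
exact: (congr1 (fun k : {linear _ -> _} => k x) e).
Qed.

Lemma image_proj_epi P (g h : hom image P) :
  g \oc image_proj = h \oc image_proj -> g = h.
Proof.
move=> e; apply: linear_ext => y; have [x <-] := im_proj_surj y.
exact: (congr1 (fun k : {linear _ -> _} => k x) e).
Qed.

End ImageFactorization.

(** * Recollements *)

Section Recollement.
Variables (K : fieldType) (A B C : fdAlgebra K) (R : recollement A B C).

Local Notation il := (i_lower_star R).
Local Notation jk := (j_lower_shriek R).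
Local Notation ju := (j_upper_star R).
Local Notation js := (j_lower_star R).
Local Notation ie := (intermediate_ext R).
Local Notation eps X := (counit (adj_jUs_jLs R) X).

Lemma ie_incl X Y (f : hom X Y) :
  image_incl (canonical R Y) \oc fmap ie f =
  fmap js f \oc image_incl (canonical R X).
Proof. exact: linear_ext. Qed.

(** Composition with the canonical map identifies Hom(X, Y) with
    Hom(j_! X, j_* Y): this is the inverse of the bijection
    Hom(j_! X, j_* Y) ~ Hom(X, j^* j_* Y) ~ Hom(X, Y). *)
Lemma counit_adj_canonical X Y (f : hom X Y) :
  eps Y \oc adj (adj_jLk_jUs R) (fmap js f \oc canonical R X) = f.
Proof.
by rewrite adj_natr comp_assoc -counit_nat -comp_assoc canonicalE comp_idr.
Qed.

Lemma canonical_full X Y (h : hom (jk X) (js Y)) :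
  fmap js (eps Y \oc adj (adj_jLk_jUs R) h) \oc canonical R X = h.
Proof.
have [g [_ ge]] := counit_iso (adj_jUs_jLs R) Y (j_lower_star_ff R).
apply: (@adj_inj _ _ _ _ (adj_jLk_jUs R)).
rewrite -[LHS]comp_idl -[RHS]comp_idl -ge -!comp_assoc.
by rewrite counit_adj_canonical.
Qed.

(** The preimage of [h] is read off from the morphism j_! X -> j_* Y that [h]
    induces; cancelling the projection and the inclusion shows that it maps back
    to [h]. *)
Lemma intermediate_ext_ff : fully_faithful ie.
Proof.
move=> X Y.
exists (fun h => eps Y \oc adj (adj_jLk_jUs R)
  (image_incl (canonical R Y) \oc h \oc image_proj (canonical R X))).
  move=> f; rewrite ie_incl -comp_assoc image_factor.
  exact: counit_adj_canonical.
move=> h; apply: image_incl_mono; apply: image_proj_epi.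
by rewrite ie_incl -comp_assoc image_factor canonical_full.
Qed.

Lemma ju_il_zero X : is_zero (ju (il X)).
Proof. by apply/im_ker; exists X; exact: iso_refl. Qed.

(** The target embeds in j_* Y, and morphisms i_* X -> j_* Y correspond to
    morphisms j^* i_* X -> Y out of a zero module. *)
Lemma hom_i_ie : hom_orthogonal il ie.
Proof.
move=> X Y f; apply: image_incl_mono.
apply: (can_inj (@adj_invK _ _ _ _ (adj_jUs_jLs R) _ _)).
exact/hom_from_zero/ju_il_zero.
Qed.

(** The source is a quotient of j_! Y, and morphisms j_! Y -> i_* X correspond
    to morphisms Y -> j^* i_* X into a zero module. *)
Lemma hom_ie_i : hom_orthogonal ie il.
Proof.
move=> Y X f; apply: image_proj_epi.
apply: (@adj_inj _ _ _ _ (adj_jLk_jUs R)).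
exact/hom_to_zero/ju_il_zero.
Qed.

End Recollement.

Theorem theorem0p1 (K : fieldType) (A B C : fdAlgebra K)
    (R : recollement A B C) :
  [/\ (* (a) *)
      forall S : (modcat A -> Prop) -> Prop,
        semibrick S -> semibrick (fimage (i_lower_star R) S),
      (* (b) *)
      forall S : (modcat C -> Prop) -> Prop, semibrick S ->
        [/\ semibrick (fimage (j_lower_shriek R) S),
            semibrick (fimage (j_lower_star R) S)
          & semibrick (fimage (intermediate_ext R) S)],
      (* (c) *)
      forall (SL : (modcat A -> Prop) -> Prop)
             (SR : (modcat C -> Prop) -> Prop),
        semibrick SL -> semibrick SR ->
        disjoint_classes (fimage (i_lower_star R) SL)
                         (fimage (intermediate_ext R) SR) /\
        semibrick (union_classes (fimage (i_lower_star R) SL)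
                                 (fimage (intermediate_ext R) SR))
    & forall (SL SL' : (modcat A -> Prop) -> Prop)
             (SR SR' : (modcat C -> Prop) -> Prop),
        semibrick SL -> semibrick SR -> semibrick SL' -> semibrick SR' ->
        union_classes (fimage (i_lower_star R) SL)
                      (fimage (intermediate_ext R) SR) =
        union_classes (fimage (i_lower_star R) SL')
                      (fimage (intermediate_ext R) SR') ->
        (SL, SR) = (SL', SR')].
Proof.
have ffi := i_lower_star_ff R; have ffe := @intermediate_ext_ff _ _ _ _ R.
have ie0 := @hom_i_ie _ _ _ _ R; have ei0 := @hom_ie_i _ _ _ _ R.
split=> [S Ssemi | S Ssemi | SL SR SLsemi SRsemi |].
- exact: ff_semibrick.
- split; apply: ff_semibrick => //.
    exact: j_lower_shriek_ff.
  exact: j_lower_star_ff.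
- split; first exact: orthogonal_disjoint.
  exact: orthogonal_union_semibrick.
move=> SL SL' SR SR' SLsemi SRsemi SL'semi SR'semi e.
have unionC (S T : (modcat B -> Prop) -> Prop) :
    union_classes S T = union_classes T S.
  by apply/funext => c; apply/propext; rewrite /union_classes orC.
(* Swapping the two parts lets the same lemma recover SR. *)
have e' := e; rewrite ![union_classes (fimage (i_lower_star R) _) _]unionC in e'.
congr (_, _); apply/funext => c; apply/propext; split.
- exact: orthogonal_union_sub e c.
- exact: orthogonal_union_sub (esym e) c.
- exact: orthogonal_union_sub e' c.
exact: orthogonal_union_sub (esym e') c.
Qed.
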